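(* Let $A_{j-1},A_j\in\mathbb{R}^{n\times n}$ be symmetric positive definite, let $b_{j-1},b_j,\bar x_{j-1},\bar x_j\in\mathbb{R}^n$, and let $x_{j-1}^\star,x_j^\star$ be the solutions of $A_{j-1}x_{j-1}^\star=b_{j-1}$ and $A_jx_j^\star=b_j$. Let $C\in\mathbb{R}^{q\times n}$ and let $Z_j\in\mathbb{R}^{n\times z_j}$ have full column rank. Define $$\eta_j^\star=(Z_j^TA_jZ_j)^{-1}Z_j^T(b_j-A_j\bar x_j),\qquad \bar\eta_j^\star=(CZ_j)^+C(x_j^\star-\bar x_j),\qquad \eta_j^{\mathrm{prev}}=(Z_j^TA_{j-1}Z_j)^{-1}Z_j^T(b_{j-1}-A_{j-1}\bar x_{j-1}).$$ If $A_{j-1}=A_j$ and $x_j^\star-\bar x_j=x_{j-1}^\star-\bar x_{j-1}$, then $\eta_j^\star=\eta_j^{\mathrm{prev}}$. Alternatively, if $C^TC=A_{j-1}$ and $x_j^\star-\bar x_j=x_{j-1}^\star-\bar x_{j-1}$, then $\bar\eta_j^\star=\eta_j^{\mathrm{prev}}$.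
   Context: A superscript $+$ denotes the Moore–Penrose pseudoinverse. *)

(* Defs.v *)
From HB Require Import structures.
From mathcomp Require Import all_boot all_order all_algebra.
From mathcomp Require Import boolp classical_sets reals.
Set Implicit Arguments.
Unset Strict Implicit.
Unset Printing Implicit Defensive.
Import Order.TTheory GRing.Theory Num.Theory.
Local Open Scope ring_scope.

Definition spd (R : realType) (n : nat) (A : 'M[R]_n) : Prop :=
  A^T = A /\ forall v : 'cV[R]_n, v != 0 -> 0 < (v^T *m A *m v) 0 0.

(* The four Penrose equations. *)
Definition penrose (R : realType) (m n : nat)
    (A : 'M[R]_(m, n)) (X : 'M[R]_(n, m)) : Prop :=
  [/\ A *m X *m A = A, X *m A *m X = X,
      (A *m X)^T = A *m X & (X *m A)^T = X *m A].

(* The default value 0 is never used, and the choice is unique: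
   see mpinvP and mpinv_unique. *)
Definition mpinv (R : realType) (m n : nat) (A : 'M[R]_(m, n)) : 'M[R]_(n, m) :=
  xget 0 [set X | penrose A X]%classic.

Lemma penrose_unique (R : realType) (m n : nat) (A : 'M[R]_(m, n))
    (X Y : 'M[R]_(n, m)) :
  penrose A X -> penrose A Y -> X = Y.
Proof.
move=> [X1 X2 X3 X4] [Y1 Y2 Y3 Y4].
have AXY : A *m X = A *m Y.
  have E : A *m X = (A *m Y) *m (A *m X) by rewrite mulmxA Y1.
  by rewrite E -Y3 -X3 -trmx_mul mulmxA X1 Y3.
have XYA : X *m A = Y *m A.
  have E : X *m A = (X *m A) *m (Y *m A) by rewrite -mulmxA (mulmxA A) Y1.
  by rewrite E -X4 -Y4 -trmx_mul -mulmxA (mulmxA A) X1 Y4.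
by rewrite -X2 -mulmxA AXY mulmxA XYA Y2.
Qed.

Lemma gram_unitmx (R : realType) (m n : nat) (M : 'M[R]_(m, n)) :
  row_free M -> M *m M^T \in unitmx.
Proof.
move=> fM; rewrite -row_free_unit -kermx_eq0; apply/eqP/row_matrixP => i.
set v := row i _; rewrite row0.
have v0 : v *m (M *m M^T) = 0 by apply/sub_kermxP; exact: row_sub.
have w0 : v *m M = 0.
  have : (v *m M) *m (v *m M)^T = 0 by rewrite trmx_mul mulmxA -(mulmxA v) v0 mul0mx.
  move/matrixP/(_ 0 0); rewrite !mxE => /eqP.
  rewrite psumr_eq0 => [/allP h|k _]; last by rewrite [(_^T) _ _]mxE -expr2 sqr_ge0.
  apply/rowP => k; have := h k (mem_index_enum k).
  by rewrite [(_^T) _ _]mxE -expr2 sqrf_eq0 => /eqP ->; rewrite mxE.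
by apply: (row_free_inj fM); rewrite w0 mul0mx.
Qed.

Lemma penrose_exists (R : realType) (m n : nat) (A : 'M[R]_(m, n)) :
  exists X, penrose A X.
Proof.
have [r [B [D [AE fB fD]]]] : exists r (B : 'M_(m, r)) (D : 'M_(r, n)),
    [/\ A = B *m D, row_full B & row_free D].
  exists (\rank A), (col_base A), (row_base A).
  by rewrite mulmx_base col_base_full row_base_free.
have uB : B^T *m B \in unitmx.
  rewrite -{2}[B]trmxK; apply: gram_unitmx.
  by rewrite /row_free mxrank_tr.
have uD : D *m D^T \in unitmx by exact: gram_unitmx.
pose P := invmx (B^T *m B) *m B^T; pose Q := D^T *m invmx (D *m D^T).
have PB : P *m B = 1%:M by rewrite /P -mulmxA mulVmx.
have DQ : D *m Q = 1%:M by rewrite /Q mulmxA mulmxV.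
have AX : A *m (Q *m P) = B *m P by rewrite AE mulmxA -(mulmxA B) DQ mulmx1.
have XA : (Q *m P) *m A = Q *m D by rewrite AE mulmxA -(mulmxA Q) PB mulmx1.
exists (Q *m P); split.
- by rewrite AX AE mulmxA -(mulmxA B) PB mulmx1.
- by rewrite XA mulmxA -(mulmxA Q) DQ mulmx1.
- by rewrite AX /P !trmx_mul trmx_inv trmx_mul !trmxK mulmxA.
- by rewrite XA /Q !trmx_mul trmx_inv trmx_mul !trmxK mulmxA.
Qed.

Lemma mpinvP (R : realType) (m n : nat) (A : 'M[R]_(m, n)) :
  penrose A (mpinv A).
Proof.
exact: (xgetPex 0 (penrose_exists A)).
Qed.

Lemma mpinv_unique (R : realType) (m n : nat) (A : 'M[R]_(m, n))
    (X : 'M[R]_(n, m)) :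
  penrose A X -> mpinv A = X.
Proof. exact: penrose_unique (mpinvP A). Qed.

(* Main.v *)
Require Import Defs.
From HB Require Import structures.
From mathcomp Require Import all_boot all_order all_algebra.
From mathcomp Require Import reals.
Import Order.TTheory GRing.Theory Num.Theory.
Local Open Scope ring_scope.


(** Put e = x* - xbar, the common error.  A residual is the matrix applied to
    the error, b - A xbar = A e, so every Galerkin coefficient vector has the
    form (Z^T A Z)^-1 Z^T A e and depends only on A and e; this gives the first
    claim.  When C^T C = A, the same vector is the solution
    ((C Z)^T (C Z))^-1 (C Z)^T (C e) of the normal equations for the least
    squares problem of fitting C e by the columns of C Z.  Positive definiteness
    of A and full column rank of Z make the Gram matrix (C Z)^T (C Z) = Z^T A Z
    invertible ([spd_congr], [spd_unitmx]), and then the normal equations compute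
    the pseudoinverse of C Z ([mpinv_normal_eq]), which gives the second claim. *)

Lemma spd_unitmx (R : realType) (n : nat) (A : 'M[R]_n) :
  spd A -> A \in unitmx.
Proof.
move=> [_ Apos]; rewrite -row_free_unit -kermx_eq0.
apply/eqP/row_matrixP => i; rewrite row0; set v := row i _.
have vA0 : v *m A = 0 by apply/sub_kermxP; exact: row_sub.
have [//|v_neq0] := eqVneq v 0.
have vT_neq0 : v^T != 0 by rewrite trmx_eq0.
by have := Apos _ vT_neq0; rewrite trmxK vA0 mul0mx mxE ltxx.
Qed.

(** Full column rank means that Z v is nonzero for every nonzero v, so the form
    of Z^T A Z at v is that of A at the nonzero vector Z v. *)
Lemma spd_congr (R : realType) (n z : nat) (A : 'M[R]_n) (Z : 'M[R]_(n, z)) :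
  spd A -> \rank Z = z -> spd (Z^T *m A *m Z).
Proof.
move=> [Asym Apos] rZ; split; first by rewrite !trmx_mul trmxK Asym mulmxA.
move=> v v_neq0.
have Zv_neq0 : Z *m v != 0.
  have ZT_free : row_free Z^T by rewrite /row_free mxrank_tr rZ.
  rewrite -trmx_eq0 trmx_mul -(mul0mx _ Z^T) (inj_eq (row_free_inj ZT_free)).
  by rewrite trmx_eq0.
by have := Apos _ Zv_neq0; rewrite trmx_mul !mulmxA.
Qed.

(** The matrix (M^T M)^-1 M^T is a left inverse of M, which leaves only the
    symmetry of M (M^T M)^-1 M^T to check among the Penrose equations. *)
Lemma mpinv_normal_eq (R : realType) (m n : nat) (M : 'M[R]_(m, n)) :
  M^T *m M \in unitmx -> mpinv M = invmx (M^T *m M) *m M^T.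
Proof.
move=> uG; set X := _ *m M^T.
have XM : X *m M = 1%:M by rewrite /X -mulmxA mulVmx.
apply: mpinv_unique; split.
- by rewrite -mulmxA XM mulmx1.
- by rewrite XM mul1mx.
- by rewrite /X !trmx_mul trmx_inv trmx_mul !trmxK mulmxA.
- by rewrite XM trmx1.
Qed.

Theorem corollary3p4 (R : realType) (n q zj : nat)
    (Aprev Aj : 'M[R]_n) (bprev bj xbarprev xbarj xstarprev xstarj : 'cV[R]_n)
    (C : 'M[R]_(q, n)) (Zj : 'M[R]_(n, zj))
    (Aprev_spd : spd Aprev) (Aj_spd : spd Aj)
    (xstarprev_sol : Aprev *m xstarprev = bprev)
    (xstarj_sol : Aj *m xstarj = bj)
    (Zj_full_col_rank : \rank Zj = zj) :
  let eta_star := invmx (Zj^T *m Aj *m Zj) *m Zj^T *m (bj - Aj *m xbarj) in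
  let etabar_star := mpinv (C *m Zj) *m C *m (xstarj - xbarj) in
  let eta_prev :=
    invmx (Zj^T *m Aprev *m Zj) *m Zj^T *m (bprev - Aprev *m xbarprev) in
  (Aprev = Aj -> xstarj - xbarj = xstarprev - xbarprev ->
     eta_star = eta_prev) /\
  (C^T *m C = Aprev -> xstarj - xbarj = xstarprev - xbarprev ->
     etabar_star = eta_prev).
Proof.
move=> eta_star etabar_star eta_prev.
rewrite /eta_star /etabar_star /eta_prev -xstarprev_sol -xstarj_sol -!mulmxBr.
split=> [-> -> // | CTC ->].
have gramE : (C *m Zj)^T *m (C *m Zj) = Zj^T *m Aprev *m Zj.
  by rewrite -CTC trmx_mul !mulmxA.
rewrite mpinv_normal_eq gramE; last exact/spd_unitmx/spd_congr.
by rewrite trmx_mul -!mulmxA (mulmxA C^T) CTC.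
Qed.
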